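(* Let $\theta$ be an arbitrary infinite cardinal. Let $\kappa=\beth_\omega(\theta)$, and consider the group $G=\bigoplus_{\alpha<\kappa}(\mathbb Z/4\mathbb Z)$. Then, for every finite $n$, we have $G\rightarrow(n)_{\theta}^{\cdot+\cdot}$.
   Context: The cardinal numbers $\beth_\alpha(\theta)$ are defined recursively by $\beth_0(\theta)=\theta$, $\beth_{\alpha+1}(\theta)=2^{\beth_\alpha(\theta)}$, and $\beth_\alpha(\theta)=\sup\{\beth_\xi(\theta) \mid \xi<\alpha\}$ if $\alpha$ is a limit ordinal. For a commutative (additively written) semigroup $G$ and cardinal numbers $\lambda,\theta$, the symbol $G\rightarrow(\lambda)_\theta^{\cdot+\cdot}$ denotes the statement: for every colouring (i.e. function) $c:G\longrightarrow\theta$ there exists a subset $X\subseteq G$ with $|X|=\lambda$ such that $X+X$ is monochromatic (i.e. $c$ is constant on $X+X$), where $X+X=\{x+y \mid x,y\in X\}$; here $x=y$ is allowed, so $X+X$ contains all elements $2x$ with $x\in X$. *)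

(* Defs.v *)
From mathcomp Require Import all_boot all_algebra.
From mathcomp Require Import boolp classical_sets functions cardinality.
From mathcomp Require Import monalg.

Set Implicit Arguments.
Unset Strict Implicit.
Unset Printing Implicit Defensive.

Local Open Scope classical_set_scope.
Local Open Scope card_scope.
Local Open Scope ring_scope.

(* A cardinal is represented by any type having that cardinality; cardinals
   are compared by injections ([#<=]) and bijections ([#=]). *)

(* beth_n(theta) for a finite index n: no limit step occurs below omega. *)
Fixpoint beth (Theta : Type) (n : nat) : Type :=
  if n is m.+1 then set (beth Theta m) else Theta.

(* |K| = sup_i |F i|, the supremum being taken in the order of cardinals. *)
Definition is_card_sup (I : Type) (F : I -> Type) (K : Type) : Prop :=
  (forall i, [set: F i] #<= [set: K]) /\
  (forall L : Type, (forall i, [set: F i] #<= [set: L]) ->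
     [set: K] #<= [set: L]).

(* |K| = beth_omega(theta): the limit step of the recursion at omega. *)
Definition is_beth_omega (Theta K : Type) : Prop := is_card_sup (beth Theta) K.

Definition sumset (G : addSemigroupType) (X : set G) : set G :=
  [set x + y | x in X & y in X].

Definition monochromatic (T Theta : Type) (c : T -> Theta) (A : set T) : Prop :=
  forall a b, A a -> A b -> c a = c b.

(* G -> (lambda)^{. + .}_theta, where lambda = |L| and theta = |Theta|;
   an [addSemigroupType] is a commutative additive semigroup. *)
Definition sum_arrow (G : addSemigroupType) (L Theta : Type) : Prop :=
  forall c : G -> Theta,
  exists X : set G, X #= [set: L] /\ monochromatic c (sumset X).

(* The direct sum of copies of the abelian group A indexed by K:
   [{malg A[K]}] is the additive group of finitely supported functions K -> A,
   with coordinatewise addition (its algebra structures play no role here). *)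
Definition direct_sum (A : zmodType) (K : choiceType) : zmodType := {malg A[K]}.

(* Main.v *)
Require Import Defs.
From mathcomp Require Import all_boot all_algebra.
From mathcomp Require Import boolp classical_sets functions cardinality.
From mathcomp Require Import monalg.

Local Open Scope classical_set_scope.

(** Colour tuples [p : K^n] by the [c]-colour of [2 (e_(p 0) + ... + e_(p (n-1)))].
Because [K] is larger than every finite iterate of the power set, a pigeonhole
on slices produces pairs [a_k <> b_k] such that all tuples in the combinatorial
cube [{a_0, b_0} x ... x {a_(n-1), b_(n-1)}] have the same colour.  Put
[w_k = 2 (e_(a_k) + e_(b_k))], so that [2 w_k = 0], and
[x_i = e_(a_0) + ... + e_(a_(n-1)) + w_i].  Then [x_i + x_j] is the element
attached to the vertex of the cube where [a] is replaced by [b] exactly at the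
coordinates [i] and [j] (at none of them when [i = j]).  The coordinates range
over disjoint subsets of [K], which makes the [w_i] distinct. *)

Definition embeds (T U : Type) : Prop := exists f : T -> U, injective f.

Lemma embeds_trans {T U V : Type} : embeds T U -> embeds U V -> embeds T V.
Proof. by move=> [f fI] [g gI]; exists (g \o f); apply: inj_comp. Qed.

Lemma card_le_embeds {T U : Type} : ([set: T] #<= [set: U])%card -> embeds T U.
Proof.
move=> /card_leP[f].
exists (fun x => val (f (SigSub (mem_set (I : [set: T] x))))).
by move=> x y /val_inj /(inj (f := f)) e; have := e (mem_set I) (mem_set I); case.
Qed.

Lemma embeds_sum {T T' U U' : Type} :
  embeds T T' -> embeds U U' -> embeds (T + U) (T' + U').
Proof.
move=> [f fI] [g gI].
exists (fun s => match s with inl x => inl (f x) | inr y => inr (g y) end).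
by move=> [x|y] [x'|y'] // []; [move=> /fI -> | move=> /gI ->].
Qed.

Lemma set1_inj {T : Type} : injective (@set1 T).
Proof. by move=> x y e; have : [set y] x by rewrite -e. Qed.

Lemma embeds_set {T U : Type} : embeds T U -> embeds (set T) (set U).
Proof.
move=> [f fI]; exists (image^~ f) => A B e.
suff AE C : C = f @^-1` (f @` C) by rewrite (AE A) e -AE.
by apply/seteqP; split=> [y Cy|y [z Cz /fI <-] //]; exists y.
Qed.

(** The empty set serves as a tag: it belongs to the code of [inr x] but not to that of [inl x],
    while [[set x]] belongs to both. *)
Lemma embeds_double (T : Type) : embeds (T + T) (set (set T)).
Proof.
have n0 (x : T) : [set x] <> set0 by move=> e; have : set0 x by rewrite -e.
exists (fun s => match s with
  inl x => [set [set x]] | inr x => [set [set x]; set0] end).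
move=> [x|x] [y|y] e.
- have xy : [set [set y]] [set x] by rewrite -e.
  by congr inl; apply: set1_inj.
- have /esym/n0 // : [set [set x]] (@set0 T) by rewrite e; right.
- have /esym/n0 // : [set [set y]] (@set0 T) by rewrite -e; right.
- have [xy|/n0 //] : [set [set y]; set0] [set x] by rewrite -e; left.
  by congr inr; apply: set1_inj.
Qed.

Lemma embeds_prod_set (T U : Type) : embeds (T * U) (set (T + U)).
Proof.
exists (fun p => [set inl p.1; inr p.2]) => -[x y] [x' y'] /= e.
have [[->]|//] : [set inl x'; inr y'] (inl x : T + U)%type.
  by rewrite -e; left.
by have [//|[->]] : [set inl x'; inr y'] (inr y : T + U)%type
  by rewrite -e; right.
Qed.

Lemma embeds_fun_set (T U : Type) : embeds (T -> U) (set (T * U)).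
Proof.
exists (fun f => [set p | p.2 = f p.1]) => f g e; apply/funext => x.
by have : [set p | p.2 = g p.1] (x, f x) by rewrite -e.
Qed.

(** Diagonal argument: [F D] must lie in [D], so some [A] omitting [F D] has the same image as
    [D]. *)
Lemma set_noninjective {T : Type} (F : set T -> T) :
  exists A B : set T, A <> B /\ F A = F B.
Proof.
pose D : set T := [set y | exists2 A, F A = y & ~ A y].
have [DF|nDF] := pselect (D (F D)).
  by have [A FA nA] := DF; exists A, D; split=> // AD; apply: nA; rewrite AD.
by exfalso; apply: (nDF); exists D.
Qed.

(** Cardinality strictly below beth_omega. *)
Definition beth_bounded (Theta T : Type) : Prop :=
  exists m, embeds T (beth Theta m).

Lemma beth_le {Theta : Type} {m k : nat} :
  m <= k -> embeds (beth Theta m) (beth Theta k).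
Proof.
move=> /subnK <-; elim: (k - m)%N => [|d IH]; first by exists id.
by apply: embeds_trans IH _; exists set1; apply: set1_inj.
Qed.

Lemma beth_bounded_embeds {Theta T U : Type} :
  embeds T U -> beth_bounded Theta U -> beth_bounded Theta T.
Proof. by move=> TU [m Um]; exists m; apply: embeds_trans TU Um. Qed.

Lemma beth_bounded_set {Theta T : Type} :
  beth_bounded Theta T -> beth_bounded Theta (set T).
Proof. by move=> [m Tm]; exists m.+1; apply: embeds_set. Qed.

Lemma beth_bounded_sum {Theta T U : Type} :
  beth_bounded Theta T -> beth_bounded Theta U -> beth_bounded Theta (T + U).
Proof.
move=> [m Tm] [k Uk]; exists (maxn m k).+2.
apply: embeds_trans (embeds_double _).
apply: embeds_sum; [apply: embeds_trans Tm _ | apply: embeds_trans Uk _].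
- exact/beth_le/leq_maxl.
- exact/beth_le/leq_maxr.
Qed.

Lemma beth_bounded_prod {Theta T U : Type} :
  beth_bounded Theta T -> beth_bounded Theta U -> beth_bounded Theta (T * U).
Proof.
move=> Tb Ub; apply: beth_bounded_embeds (embeds_prod_set T U) _.
exact/beth_bounded_set/beth_bounded_sum.
Qed.

Lemma beth_bounded_fun {Theta T U : Type} :
  beth_bounded Theta T -> beth_bounded Theta U -> beth_bounded Theta (T -> U).
Proof.
move=> Tb Ub; apply: beth_bounded_embeds (embeds_fun_set T U) _.
exact/beth_bounded_set/beth_bounded_prod.
Qed.

(* Only the coordinates below [n] of [p : nat -> B] are meant to matter. *)
Definition monochromatic_cubes (Theta B : Type) (n : nat) : Prop :=
  forall f : (nat -> B) -> Theta, exists a b : nat -> B,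
    (forall k, k < n -> a k <> b k) /\
    (forall e : pred nat, f (fun k => if e k then b k else a k) = f a).

(* Two points of the new factor have the same slice by Cantor's theorem; the
   cube is then found inside this common slice. *)
Lemma monochromatic_cubesS {Theta B : Type} {n : nat} :
  monochromatic_cubes Theta B n ->
  monochromatic_cubes Theta (B + set ((nat -> B) -> Theta)) n.+1.
Proof.
set B' := (B + _)%type => cubeB f.
pose upd (s : B') (p : nat -> B) k := if k == n then s else inl (p k).
(* A slice is a colouring of [nat -> B], and the points [inr S] are indexed by sets of such
   colourings. *)
have [S [T [neqST eqST]]] := set_noninjective (fun S p => f (upd (inr S) p)).
have [a [b [neqab fE]]] := cubeB (fun p => f (upd (inr S) p)).
exists (upd (inr S) a), (upd (inr T) b); split=> [k|e].
  rewrite ltnS leq_eqVlt /upd; case: eqP => [_ _ []//|_ /= /neqab nab].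
  by case.
rewrite -(fE e).
transitivity
  (f (upd (inr (if e n then T else S)) (fun k => if e k then b k else a k))).
  congr f; apply/funext => k; rewrite /upd.
  by case: eqP => [->|_]; case: (e _).
by case: (e n) => //; have := congr1 (@^~ (fun k => if e k then b k else a k)) eqST.
Qed.

(** Each new coordinate enlarges [B] by finitely many power sets only, so the size stays below
    beth_omega. *)
Lemma beth_bounded_cubes {Theta : Type} (n : nat) :
  beth_bounded Theta nat ->
  exists2 B, beth_bounded Theta B & monochromatic_cubes Theta B n.
Proof.
move=> natb; elim: n => [|n [B Bb cubeB]].
  exists nat => // f; exists id, id; split=> // e.
  by congr f; apply/funext => k; case: ifP.
exists (B + set ((nat -> B) -> Theta))%type; last exact: monochromatic_cubesS.
apply: (beth_bounded_sum Bb); apply: beth_bounded_set.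
apply: beth_bounded_fun; last by exists 0, id.
exact: beth_bounded_fun natb Bb.
Qed.

Local Open Scope ring_scope.
Import GRing.Theory.

(** For [i <> j], adding [w] at both places turns [u] into [v] there; for [i = j], the two copies of
    [w i] cancel. *)
Lemma sum_cube {G : zmodType} {n : nat} (u v w : nat -> G) (i j : 'I_n) :
  (forall k, v k *+ 2 = u k *+ 2 + w k) -> (forall k, w k *+ 2 = 0) ->
  (\sum_(k < n) (if (k == i) (+) (k == j) then v k else u k)) *+ 2 =
  (\sum_(k < n) u k + w i) + (\sum_(k < n) u k + w j).
Proof.
move=> vE w2.
rewrite addrACA -mulr2n.
have pick (l : 'I_n) : w l = \sum_(k < n) w k *+ (k == l).
  rewrite (bigD1 l) //= eqxx big1 ?addr0 // => k /negbTE ->.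
  by rewrite mulr0n.
rewrite (pick i) (pick j) -!sumrMnl -!big_split /=; apply: eq_bigr => k _.
by case: eqP; case: eqP => _ _ /=; rewrite ?vE ?addr0 ?add0r // -mulr2n w2 addr0.
Qed.

Theorem proposition7 (Theta : Type) (Theta_infinite : infinite_set [set: Theta])
    (K : choiceType) (K_beth_omega : is_beth_omega Theta K) (n : nat) :
  sum_arrow (direct_sum 'Z_4 K) 'I_n Theta.
Proof.
move=> c.
have natb : beth_bounded Theta nat.
  by exists 0%N; apply: card_le_embeds; apply/infiniteP.
have [B Bb cubeB] := beth_bounded_cubes n natb.
have [J JI] : embeds (nat * B) K.
  have [m NBm] := beth_bounded_prod natb Bb.
  by apply: embeds_trans NBm (card_le_embeds _); case: K_beth_omega.
pose G : zmodType := direct_sum 'Z_4 K.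
pose u k b : G := << 1 *g J (k, b) >>.
have [a [b [neqab cE]]] :=
  cubeB (fun p => c ((\sum_(k < n) u k (p k)) *+ 2)).
pose w k := (u k (a k) + u k (b k)) *+ 2.
pose x (i : 'I_n) : G := \sum_(k < n) u k (a k) + w i.
(* Exponent 4 yields both hypotheses of [sum_cube]. *)
have G4 (g : G) : g *+ 4 = 0.
  apply/malgP => k; rewrite mcoeffMn mcoeff0 -mulr_natr.
  by rewrite (_ : 4%:R = 0) ?mulr0 //; apply/val_inj.
have xI : injective x.
  move=> i j /addrI; case: (eqVneq i j) => [//|neqij].
  (* At this index [w i] has coefficient 2, nonzero modulo 4, and [w j] has coefficient 0. *)
  move=> /(congr1 (mcoeff (J (i : nat, a i)))).
  have off d : J (j : nat, d) == J (i : nat, a i) = false.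
    by apply/eqP => /JI[/val_inj ji]; rewrite ji eqxx in neqij.
  have off' : J (i : nat, b i) == J (i : nat, a i) = false.
    by apply/eqP => /JI[ba]; exact: (neqab i (ltn_ord i) (esym ba)).
  by rewrite /w !mcoeffMn !mcoeffD /u !mcoeffU !off off' eqxx => /eqP.
exists (range x); split; first by apply: inj_card_eq; apply: in2W xI.
have xD i j : c (x i + x j) = c ((\sum_(k < n) u k (a k)) *+ 2).
  rewrite /x -(sum_cube (fun k => u k (a k)) (fun k => u k (b k))); first last.
  - by move=> k; rewrite /w -mulrnA; apply: G4.
  - by move=> k; rewrite /w mulrnDl addrA -mulrnDr (G4 (u k (a k))) add0r.
  (* The vertex of the cube that switches from [a] to [b] exactly where [i] and [j] differ. *)
  pose e (k : nat) := (k == i) (+) (k == j).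
  rewrite -(cE e) /e; congr (c (_ *+ 2)); apply: eq_bigr => k _.
  by rewrite -!(inj_eq val_inj) /=; case: ifP.
by move=> _ _ [_ [i _ <-] [_ [j _ <-] <-]] [_ [k _ <-] [_ [l _ <-] <-]]; rewrite !xD.
Qed.
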